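(* Let $(\mathcal{X},\mathscr{A})$ be a measurable space and, for each integer $k\ge1$, let $t_k:\mathcal{X}^k\to\mathbb{R}^m$ be measurable. Let $(\delta_1,\xi_1),(\delta_2,\xi_2),\ldots$ be independent copies of $(\delta,\xi)$, where $\delta$ is Bernoulli with parameter $p>0$ and $\xi$ is an $\mathcal{X}$-valued random variable. Let $\tilde\xi_1,\tilde\xi_2,\ldots$ be independent with common distribution the conditional distribution of $\xi$ given $\delta=1$. Let $T_{c,n}$ be the complete case statistic associated with $(t_n)$, let $\psi:\mathcal{X}\to\mathbb{R}^m$ be measurable, and set $N=\sum_{j=1}^n\delta_j$. Suppose that $$n^{1/2}\Bigl(t_n(\tilde\xi_1,\ldots,\tilde\xi_n)-\frac1n\sum_{j=1}^n\psi(\tilde\xi_j)\Bigr)=o_P(1).$$ Then $$\sqrt N\Bigl(T_{c,n}-\frac1N\sum_{j=1}^n\delta_j\psi(\xi_j)\Bigr)=o_P(1),$$ and, consequently, $$T_{c,n}=\frac1N\sum_{j=1}^n\delta_j\psi(\xi_j)+o_P(n^{-1/2}).$$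
   Context: The complete case statistic associated with $(t_n)$ is $$T_{c,n}=\sum_{A\subset\{1,\ldots,n\}}\Bigl\{\prod_{i\in A}\delta_i\Bigr\}\Bigl\{\prod_{i\notin A}(1-\delta_i)\Bigr\}t_{|A|}(\xi^A),$$ where $t_0(\xi^{\varnothing})$ is a (fixed) constant in $\mathbb{R}^m$, $|A|$ is the cardinality of $A$, and $\xi^A=(\xi_{i_1},\ldots,\xi_{i_k})$ with $i_1<\cdots<i_k$ the elements of the non-empty set $A$. On the event $N=0$ the average $\frac1N\sum_{j=1}^n\delta_j\psi(\xi_j)$ is taken to be an arbitrary fixed constant. *)

(* Defs.v *)
From HB Require Import structures.
From mathcomp Require Import all_boot all_order all_algebra finmap.
From mathcomp Require Import all_classical all_reals all_analysis.

Set Implicit Arguments.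
Unset Strict Implicit.
Unset Printing Implicit Defensive.

Import Order.TTheory GRing.Theory Num.Theory.
Import numFieldNormedType.Exports.

Local Open Scope classical_set_scope.
Local Open Scope ring_scope.

(* R^m, as a space of row vectors, with its Borel sigma-algebra; it is used
   only as a codomain, to say that a map into R^m is Borel measurable. *)
Notation borel_rV R m := (g_sigma_algebraType (@open 'rV[R]_m)).

(* Mutual independence of the random elements Z 0, Z 1, ... of T: the product
   rule holds for every finite subfamily. *)
Definition mutually_independent d d' (Omega : measurableType d)
    (T : measurableType d') (R : realType) (P : probability Omega R)
    (Z : nat -> Omega -> T) : Prop :=
  forall (J : {fset nat}) (C : nat -> set T),
    (forall i, i \in J -> measurable (C i)) ->
    P (\bigcap_(i in [set` J]) (Z i @^-1` C i)) =
    (\prod_(i <- J) P (Z i @^-1` C i))%E.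

(* Y_n = o_P(1), that is, Y_n -> 0 in P-probability.  The norm is the library's
   sup norm on R^m; as all norms on R^m are equivalent, the choice of the norm
   is irrelevant. *)
Definition oP1 d (Omega : measurableType d) (R : realType)
    (P : probability Omega R) (m : nat) (Y : nat -> Omega -> 'rV[R]_m) : Prop :=
  forall e : R, 0 < e ->
    P [set w | e < `|Y n w|] @[n --> \oo] --> 0%E.

(* Y_n = o_P(a_n) for positive constants a_n, that is, Y_n / a_n = o_P(1). *)
Definition oP d (Omega : measurableType d) (R : realType)
    (P : probability Omega R) (m : nat) (a : nat -> R)
    (Y : nat -> Omega -> 'rV[R]_m) : Prop :=
  oP1 P (fun n w => (a n)^-1 *: Y n w).

(* In the following definitions dl and x are realizations of the sequences
   (delta_j) and (xi_j), indexed from 0: the observations with (one-based)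
   numbers 1, ..., n are those with indices j < n. *)

Definition n_complete (dl : nat -> bool) (n : nat) : nat :=
  (\sum_(j < n) dl j)%N.

(* x^A; enum_val lists the elements of A in increasing order. *)
Definition subtuple (X : Type) (x : nat -> X) (n : nat) (A : {set 'I_n}) :
    #|A|.-tuple X :=
  [tuple x (enum_val k) | k < #|A|].

(* The constant t_0 is the value of t 0 at the only element of X^0. *)
Definition complete_case (R : realType) (m : nat) (X : Type)
    (t : forall k : nat, k.-tuple X -> 'rV[R]_m) (n : nat)
    (dl : nat -> bool) (x : nat -> X) : 'rV[R]_m :=
  \sum_(A : {set 'I_n})
    ((\prod_(i in A) (dl i)%:R) * (\prod_(i | i \notin A) (1 - (dl i)%:R)))
      *: t #|A| (subtuple x A).

(* The average (1/N) sum_j delta_j psi(xi_j), which is c when N = 0. *)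
Definition complete_case_mean (R : realType) (m : nat) (X : Type)
    (psi : X -> 'rV[R]_m) (c : 'rV[R]_m) (n : nat)
    (dl : nat -> bool) (x : nat -> X) : 'rV[R]_m :=
  if n_complete dl n == 0%N then c
  else (n_complete dl n)%:R^-1 *: \sum_(j < n) (dl j)%:R *: psi (x j).

(* Main.v *)
Require Import Defs.
From HB Require Import structures.
From mathcomp Require Import all_boot all_order all_algebra finmap.
From mathcomp Require Import all_classical all_reals all_analysis.
From mathcomp Require Import measurable_realfun.
From mathcomp Require Import lra.

Set Implicit Arguments.
Unset Strict Implicit.
Unset Printing Implicit Defensive.

Import Order.TTheory GRing.Theory Num.Theory.
Import numFieldNormedType.Exports.

Local Open Scope classical_set_scope.
Local Open Scope ring_scope.

(** Given that the complete cases among the first [n] observations are those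
    with indices in [A], the vector of complete cases is distributed as [#|A|]
    independent draws from the law of [xi] given [delta = 1].  Hence an event
    about it has probability [\sum_A w_A P'(xit_1, ..., xit_#|A| \in B_#|A|)],
    where [w_A] is the probability of the pattern [A]; when
    [P'(... \in B_k)] tends to [0] with [k], so does this mixture, because
    [N] tends to infinity in probability.  The second claim follows from the
    same formula, since [N > n / M] with probability tending to one for a
    suitable constant [M], which makes [sqrt n] at most
    [sqrt M * sqrt N]. *)

(** * Weights of the patterns and binomial tails *)

Definition pattern_weight (R : realType) (p : R) n (A : {set 'I_n}) : R :=
  \prod_(j < n) (if j \in A then p else 1 - p).

Lemma pattern_weight_ge0 (R : realType) (p : R) n (A : {set 'I_n}) :
  0 <= p <= 1 -> 0 <= pattern_weight p A.
Proof.
move=> /andP[p0 p1]; apply: prodr_ge0 => j _.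
by case: ifP => // _; rewrite subr_ge0.
Qed.

(** Binomial generating function: expand the product of [n] factors [p * s + (1 - p)] over subsets.
    It serves at [s = r ^+ M] for the tail bound and at [s = 1] for the total mass. *)
Lemma pattern_weight_genfun (R : realType) (p s : R) n :
  \sum_(A : {set 'I_n}) pattern_weight p A * s ^+ #|A| =
  (1 - p + p * s) ^+ n.
Proof.
have -> : (1 - p + p * s) ^+ n = \prod_(j < n) (p * s + (1 - p)).
  by rewrite prodr_const card_ord addrC.
rewrite bigA_distr /=; apply: eq_bigr => A _.
rewrite -prodr_const big_mkcond /= -big_split /=; apply: eq_bigr => j _.
by case: ifP => _; rewrite ?mulr1.
Qed.

(* Chernoff bound: with [r = 1 - p / 2] and [r ^+ M < 1 / 2], a pattern with
   [#|A| * M <= n] satisfies [1 <= r ^+ (#|A| * M) / r ^+ n]. *)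
Lemma pattern_weight_tail_cvg0 (R : realType) (p : R) : 0 < p <= 1 ->
  exists2 M : nat, (0 < M)%N &
    \sum_(A : {set 'I_n} | (#|A| * M <= n)%N) pattern_weight p A
      @[n --> \oo] --> (0 : R).
Proof.
move=> /andP[p0 p1]; pose r : R := 1 - p / 2.
have r0 : 0 < r by rewrite /r; lra.
have r1 : r < 1 by rewrite /r; lra.
have [M M0 rM] : exists2 M : nat, (0 < M)%N & r ^+ M < 1 / 2.
  have : r ^+ n @[n --> \oo] --> 0 by apply: cvg_expr; rewrite ger0_norm // ltW.
  move=> /cvgr0Pnorm_lt/(_ (1 / 2)) [|N _ hN]; first lra.
  exists N.+1 => //.
  by have := hN N.+1 (leqnSn N); rewrite ger0_norm // exprn_ge0 // ltW.
exists M => //.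
(* The tail is at most [th ^+ n], and [th < 1] because [r ^+ M < 1 / 2] makes the numerator smaller
   than [1 - p / 2 = r]. *)
pose th := (1 - p + p * r ^+ M) / r.
have th0 : 0 <= th.
  by rewrite divr_ge0 ?ltW // ltr_wpDl ?subr_ge0 ?mulr_gt0 ?exprn_gt0.
have th1 : th < 1.
  rewrite ltr_pdivrMr // mul1r /r.
  have := rM; rewrite -(ltr_pM2l p0); lra.
apply: (@squeeze_cvgr _ _ _ _ (fun=> 0) (fun n => th ^+ n)); last 2 first.
- exact: cvg_cst.
- by apply: cvg_expr; rewrite ger0_norm.
apply: nearW => n; apply/andP; split.
  by apply: sumr_ge0 => A _; rewrite pattern_weight_ge0 // ltW.
rewrite expr_div_n -pattern_weight_genfun mulr_suml big_mkcond /=.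
have w0 (A : {set 'I_n}) : 0 <= pattern_weight p A.
  by rewrite pattern_weight_ge0 // ltW.
apply: ler_sum => A _; rewrite -exprM mulnC -mulrA; case: ifPn => [Mn|_].
  rewrite ler_peMr // ler_pdivlMr ?exprn_gt0 // mul1r.
  by rewrite ler_wiXn2l // ltW.
by rewrite mulr_ge0 // divr_ge0 // exprn_ge0 // ltW.
Qed.

(** Patterns with [#|A| * M <= n] have vanishing total weight and there [a <= 1]; the others have
    [#|A|] large, so [b #|A|] is small. [M] depends on [p] only and is fixed before [a] and [b], so
    that these may be chosen in terms of [M]. *)
Lemma pattern_weighted_sum_cvg0 (R : realType) (p : R) : 0 < p <= 1 ->
  exists2 M : nat, (0 < M)%N & forall (a : nat -> nat -> R) (b : nat -> R),
    (forall n k, 0 <= a n k <= 1) ->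
    (forall n k, (n < k * M)%N -> a n k <= b k) ->
    b k @[k --> \oo] --> 0 ->
    \sum_(A : {set 'I_n}) pattern_weight p A * a n #|A|
      @[n --> \oo] --> (0 : R).
Proof.
move=> p01; have [M M0 tail] := pattern_weight_tail_cvg0 p01.
have {}p01 : 0 <= p <= 1 by case/andP: p01 => /ltW -> ->.
exists M => // a b a01 ab b0.
apply/cvgr0Pnorm_le => e e0.
have e20 : 0 < e / 2 by lra.
have /cvgr0Pnorm_le/(_ _ e20) [K _ bK] := b0.
have /cvgr0Pnorm_le/(_ _ e20) tail_le := tail.
near=> n.
have w0 (A : {set 'I_n}) : 0 <= pattern_weight p A.
  exact: pattern_weight_ge0.
rewrite ger0_norm; last first.
  by apply: sumr_ge0 => A _; rewrite mulr_ge0 //; case/andP: (a01 n #|A|).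
rewrite (bigID (fun A : {set 'I_n} => (#|A| * M <= n)%N)) /=.
rewrite (splitr e) lerD //.
  apply: (@le_trans _ _
      `|\sum_(A : {set 'I_n} | (#|A| * M <= n)%N) pattern_weight p A|);
      last first.
    by near: n; exact: tail_le.
  apply: le_trans (ler_norm _); apply: ler_sum => A _.
  by rewrite ler_piMr //; case/andP: (a01 n #|A|).
apply: (@le_trans _ _ (\sum_(A : {set 'I_n}) pattern_weight p A * (e / 2))).
  rewrite [leLHS]big_mkcond /=; apply: ler_sum => A _.
  case: ifPn => [|_]; last by rewrite mulr_ge0 // ltW.
  rewrite -ltnNge => nA; apply: ler_wpM2l => //.
  apply: (le_trans (ab _ _ nA)); apply: le_trans (ler_norm _) _.
  (* Once [n >= K * M], the bound [n < #|A| * M] gives [K <= #|A|]. *)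
  apply: bK => /=; rewrite -(leq_pmul2r M0); apply: leq_trans (ltnW nA).
  by near: n; exists (K * M)%N.
rewrite -mulr_suml ler_piMl //; first exact: ltW.
(* The weights sum to one. *)
have := pattern_weight_genfun p 1 n.
under eq_bigr do rewrite expr1n mulr1.
by rewrite mulr1 subrK expr1n => ->.
Unshelve. all: by end_near. Qed.

(** * Joint law of the pattern and the complete cases *)

(** Rectangles form a pi-system generating the product sigma-algebra, and both sides are finite
    measures in [B]. Restricting to [E] with a factor [r] avoids conditioning on [E], whose
    probability may vanish. *)
Lemma tuple_law_unique (R : realType) d1 (T1 : measurableType d1)
    d2 (T2 : measurableType d2) dX (X : measurableType dX) (k : nat)
    (P1 : probability T1 R) (P2 : probability T2 R) (E : set T1)
    (f : T1 -> k.-tuple X) (g : T2 -> k.-tuple X) (r : {nonneg R}) :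
  measurable E -> measurable_fun [set: T1] f -> measurable_fun [set: T2] g ->
  (forall C : 'I_k -> set X, (forall i, measurable (C i)) ->
    P1 ([set w | forall i, C i (tnth (f w) i)] `&` E) =
    (r%:num%:E * P2 [set w | forall i, C i (tnth (g w) i)])%E) ->
  forall B : set (k.-tuple X), measurable B ->
    P1 ([set w | B (f w)] `&` E) = (r%:num%:E * P2 [set w | B (g w)])%E.
Proof.
move=> mE mf mg eq_rect B mB.
pose m1 : {measure set (k.-tuple X) -> \bar R} := pushforward (mrestr P1 mE) f.
pose m2 : {measure set (k.-tuple X) -> \bar R} := mscale r (pushforward P2 g).
pose rect (C : 'I_k -> set X) :=
  [set y : k.-tuple X | forall i, C i (tnth y i)].
pose G := [set rect C | C in [set C | forall i, measurable (C i)]].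
have mrect C : (forall i, measurable (C i)) -> measurable (rect C).
  move=> mC; rewrite (_ : rect C =
      \bigcap_(i in [set: 'I_k]) ((fun y : k.-tuple X => tnth y i) @^-1` C i)).
    apply: fin_bigcap_measurable => // i _.
    by rewrite -[X in measurable X]setTI; exact: measurable_tnth.
  by apply/seteqP; split => [y yC i _|y yC i]; [exact: yC|exact: (yC i)].
have GT : G setT by exists (fun=> setT) => //; apply/seteqP; split.
apply: (@measure_unique _ R _ G (fun=> setT) _ _ _ _ (m1 mf) (m2 mg)) => //.
- apply/seteqP; split; last first.
    by apply: smallest_sub; [exact: sigma_algebra_measurable|move=> _ [C mC <-];
      exact: mrect].
  apply: smallest_sub; first exact: smallest_sigma_algebra.
  move=> A; rewrite -bigcup_seq => -[i /= _ [C mC <-]].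
  apply: sub_sigma_algebra.
  (* A generating cylinder over coordinate [i] is a rectangle whose other sides are full. *)
  exists (fun j => if j == i then C else setT) => [j|].
    by case: ifP.
  apply/seteqP; split => [y /(_ i)|y [_ yC] j]; first by rewrite eqxx; split.
  by case: eqP => // ->.
- move=> _ _ [C mC <-] [D mD <-]; exists (fun i => C i `&` D i) => [i|].
    exact: measurableI.
  apply/seteqP; split => [y yCD|y [yC yD] i]; last by split.
  by split=> i; have [] := yCD i.
- by apply/seteqP; split => // y _; exists 0%N.
- by move=> _ [C mC <-]; exact: eq_rect.
- move=> _; rewrite /= /pushforward /mrestr preimage_setT setTI.
  exact: le_lt_trans (probability_le1 P1 mE) (ltry _).
Qed.

Lemma mutually_independent_ord d d' (Omega : measurableType d)
    (T : measurableType d') (R : realType) (P : probability Omega R)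
    (Z : nat -> Omega -> T) (n : nat) (C : 'I_n -> set T) :
  mutually_independent P Z -> (forall i, measurable (C i)) ->
  P [set w | forall i, C i (Z i w)] = (\prod_(i < n) P (Z i @^-1` C i))%E.
Proof.
move=> indep mC; pose J : {fset nat} := [fset i | i in iota 0 n]%fset.
have inJ i : (i \in J) = (i < n)%N by rewrite !inE /= mem_iota.
(* Independence is stated for families indexed by [nat], so [C] is extended by the full set from [n]
   on. *)
pose D (i : nat) := if insub i is Some j then C j else setT.
have DE (i : 'I_n) : D i = C i by rewrite /D valK.
rewrite (eq_bigr (fun i : 'I_n => P (Z i @^-1` D i))) => [|i _]; last first.
  by rewrite DE.
have := indep J D; rewrite (perm_big (index_iota 0 n)) /= ?big_mkord;
    last first.
  apply: uniq_perm; rewrite ?fset_uniq ?iota_uniq // => i.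
  by rewrite inJ mem_index_iota.
move=> <- => [|i _]; last by rewrite /D; case: insub.
congr (P _); apply/seteqP; split=> [w wC i /= | w wC i].
  rewrite inJ => ltin; have := wC (Ordinal ltin).
  by rewrite -DE.
by rewrite -DE; apply: wC; rewrite /= inJ.
Qed.

Definition pattern (n : nat) (dl : nat -> bool) : {set 'I_n} :=
  [set j : 'I_n | dl j].

Lemma measurable_pattern d (Omega : measurableType d) (R : realType)
    (P : probability Omega R) (delta : nat -> {RV P >-> bool}) n
    (A : {set 'I_n}) :
  measurable [set w | pattern n (delta^~ w) = A].
Proof.
rewrite (_ : [set w | _] =
    \bigcap_(j in [set: 'I_n]) (delta j @^-1` [set j \in A])).
  by apply: fin_bigcap_measurable => // j _; exact: measurable_funPTI.
apply/seteqP; split=> [w /= <- j _|w wA]; first by rewrite /= inE.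
by apply/setP => j; rewrite inE; exact: wA.
Qed.

Lemma measurable_mktuple d (Omega : measurableType d) dX (X : measurableType dX)
    k (y : 'I_k -> Omega -> X) :
  (forall i, measurable_fun [set: Omega] (y i)) ->
  measurable_fun [set: Omega] (fun w => [tuple y i w | i < k]).
Proof.
move=> my; apply/measurable_fun_tnthP => i.
by rewrite [X in measurable_fun _ X](_ : _ = y i) //;
  apply/funext => w /=; rewrite tnth_mktuple.
Qed.

Lemma measurable_mktuple_preimage d (Omega : measurableType d)
    dX (X : measurableType dX) k (y : 'I_k -> Omega -> X)
    (B : set (k.-tuple X)) :
  (forall i, measurable_fun [set: Omega] (y i)) -> measurable B ->
  measurable [set w | B [tuple y i w | i < k]].
Proof.
move=> my mB; rewrite -[X in measurable X]setTI.
have mT := measurable_mktuple my.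
exact: mT measurableT _ mB.
Qed.

(** On rectangles the event is a conjunction of conditions on the separate pairs, so independence
    factors it: an index in [A] contributes [p] times a probability for [xit], any other index
    [1 - p]. The indices [j] and [k] are unrelated in the first law hypothesis, so that the [k]-th
    element of [A] can be matched with [xit k]. *)
Lemma pattern_subtuple_law (R : realType) dX (X : measurableType dX) (p : R)
    d (Omega : measurableType d) (P : probability Omega R)
    (delta : nat -> {RV P >-> bool}) (xi : nat -> {RV P >-> X})
    d' (Omega' : measurableType d') (P' : probability Omega' R)
    (xit : nat -> {RV P' >-> X}) :
  0 <= p <= 1 ->
  mutually_independent P (fun j w => (delta j w, xi j w)) ->
  mutually_independent P' (fun j w => xit j w) ->
  (forall j k B, measurable B ->
    P [set w | delta j w /\ B (xi j w)] = (p%:E * P' (xit k @^-1` B))%E) ->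
  (forall j, P [set w | ~~ delta j w] = (1 - p)%:E) ->
  forall n (A : {set 'I_n}) (B : set (#|A|.-tuple X)), measurable B ->
    P [set w | pattern n (delta^~ w) = A /\ B (subtuple (xi^~ w) A)] =
    ((pattern_weight p A)%:E * P' [set w | B [tuple xit k w | k < #|A|]])%E.
Proof.
move=> p01 indep indep' true_law false_law n A B mB.
have mE := measurable_pattern delta A.
pose r : {nonneg R} := NngNum (pattern_weight_ge0 A p01).
have := @tuple_law_unique R _ _ _ _ _ _ _ P P' _ (fun w => subtuple (xi^~ w) A)
  (fun w => [tuple xit k w | k < #|A|]) r mE.
rewrite /r /= => <- //; first by congr (P _); rewrite setIC.
- exact: measurable_mktuple.
- exact: measurable_mktuple.
move=> C mC.
(* At most one [k] satisfies [enum_val k = j], and none does when [j] lies outside [A]; [D j] then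
   constrains only the Boolean. *)
pose D (j : 'I_n) : set (bool * X) :=
  [set z | z.1 = (j \in A) /\ forall k, enum_val k = j -> C k z.2].
have mD j : measurable (D j).
  rewrite (_ : D j = [set j \in A] `*`
      \bigcap_(k in [set k : 'I_#|A| | enum_val k = j]) C k).
    apply: measurableX => //.
    exact: fin_bigcap_measurable.
  apply/seteqP; split=> [z [? zC]|z [? zC]]; split=> //.
have -> : [set w | forall i, C i (tnth (subtuple (xi^~ w) A) i)] `&`
    [set w | pattern n (delta^~ w) = A] =
    [set w | forall j : 'I_n, D j (delta j w, xi j w)].
  apply/seteqP; split=> [w [wC /= wA] j|w wD].
    split=> /= [|k <-]; first by rewrite -wA inE.
    by have := wC k; rewrite tnth_mktuple.
  split=> [k|]; last by apply/setP => j; rewrite inE; case: (wD j).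
  by rewrite tnth_mktuple; case: (wD (enum_val k)) => _ /(_ k); exact.
rewrite (mutually_independent_ord indep mD).
have -> : [set w | forall i, C i (tnth [tuple xit k w | k < #|A|] i)] =
    [set w | forall i : 'I_#|A|, C i (xit i w)].
  by apply/seteqP; split=> w wC i; have := wC i; rewrite tnth_mktuple.
rewrite (mutually_independent_ord indep' mC).
rewrite (bigID (mem A)) /= big_enum_val /=.
have in_law (k : 'I_#|A|) :
    P [set w | D (enum_val k) (delta (enum_val k) w, xi (enum_val k) w)] =
    (p%:E * P' (xit k @^-1` C k))%E.
  rewrite -(true_law (enum_val k)) //; congr (P _).
  apply/seteqP; split=> [w [/= -> wC]|w [wd wC]].
    by rewrite enum_valP; split=> //; exact: wC.
  by split=> /= [|l /enum_val_inj ->]; rewrite ?enum_valP.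
have out_law (j : 'I_n) : j \notin A ->
    P [set w | D j (delta j w, xi j w)] = (1 - p)%:E.
  move=> jA; rewrite -(false_law j); congr (P _).
  apply/seteqP; split=> [w [/= -> _] //|w /= /negbTE wd].
  split=> [/=|k kj]; first by rewrite wd (negbTE jA).
  by move: (enum_valP k) jA; rewrite kj => ->.
under eq_bigr do rewrite in_law.
under [X in (_ * X)%E = _]eq_bigr => j jA do rewrite (out_law _ jA).
rewrite big_split /= muleAC !prodEFin -EFinM; congr (_%:E * _)%E.
rewrite /pattern_weight [RHS](bigID (mem A)) /= [in RHS]big_enum_val /=.
congr (_ * _); first by apply: eq_bigr => k _; rewrite enum_valP.
by apply: eq_bigr => j /negbTE ->.
Qed.

(** * Mixtures over the patterns *)

(** Total probability over the finitely many disjoint patterns. *)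
Lemma pattern_event_prob (R : realType) dX (X : measurableType dX) (p : R)
    d (Omega : measurableType d) (P : probability Omega R)
    (delta : nat -> {RV P >-> bool}) (xi : nat -> {RV P >-> X})
    d' (Omega' : measurableType d') (P' : probability Omega' R)
    (xit : nat -> {RV P' >-> X}) :
  0 <= p <= 1 ->
  mutually_independent P (fun j w => (delta j w, xi j w)) ->
  mutually_independent P' (fun j w => xit j w) ->
  (forall j k B, measurable B ->
    P [set w | delta j w /\ B (xi j w)] = (p%:E * P' (xit k @^-1` B))%E) ->
  (forall j, P [set w | ~~ delta j w] = (1 - p)%:E) ->
  forall n (B : forall k, set (k.-tuple X)), (forall k, measurable (B k)) ->
    P [set w | B _ (subtuple (xi^~ w) (pattern n (delta^~ w)))] =
    (\sum_(A : {set 'I_n}) pattern_weight p A *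
       fine (P' [set w | B #|A| [tuple xit k w | k < #|A|]]))%:E.
Proof.
move=> p01 indep indep' true_law false_law n B mB.
pose F (A : {set 'I_n}) :=
  [set w | pattern n (delta^~ w) = A /\ B #|A| (subtuple (xi^~ w) A)].
have -> : [set w | B _ (subtuple (xi^~ w) (pattern n (delta^~ w)))] =
    \bigcup_(A in [set: {set 'I_n}]) F A.
  apply/seteqP; split=> [w wB|w [A _ [<- //]]].
  by exists (pattern n (delta^~ w)).
rewrite measure_fin_bigcup //=.
- rewrite (fsbigTE [fset A | A in {: {set 'I_n}}]%fset) => [|A]; last first.
    by rewrite !inE.
  rewrite -sumEFin (perm_big (index_enum {set 'I_n})) /=; last first.
    apply: uniq_perm; rewrite ?fset_uniq ?index_enum_uniq // => A.
    by rewrite !inE mem_index_enum.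
  apply: eq_bigr => A _.
  rewrite EFinM fineK; last first.
    by apply: fin_num_measure; exact: measurable_mktuple_preimage.
  exact: (pattern_subtuple_law p01 indep indep' true_law false_law (mB _)).
- by move=> A A' _ _ [w [[<- _] [<- _]]].
move=> A _.
rewrite (_ : F A = [set w | pattern n (delta^~ w) = A] `&`
  (fun w => subtuple (xi^~ w) A) @^-1` B #|A|) //.
apply: measurableI; first exact: measurable_pattern.
exact: measurable_mktuple_preimage.
Qed.

(** [B] depends on [n] as well as on the length [k], so that the event may involve the norming
    [sqrt n]. Asking for the bound only when [n < k * M] lets [sqrt n] be compared with [sqrt k]. *)
Lemma pattern_events_cvg0 (R : realType) dX (X : measurableType dX) (p : R)
    d (Omega : measurableType d) (P : probability Omega R)
    (delta : nat -> {RV P >-> bool}) (xi : nat -> {RV P >-> X})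
    d' (Omega' : measurableType d') (P' : probability Omega' R)
    (xit : nat -> {RV P' >-> X}) :
  0 < p <= 1 ->
  mutually_independent P (fun j w => (delta j w, xi j w)) ->
  mutually_independent P' (fun j w => xit j w) ->
  (forall j k B, measurable B ->
    P [set w | delta j w /\ B (xi j w)] = (p%:E * P' (xit k @^-1` B))%E) ->
  (forall j, P [set w | ~~ delta j w] = (1 - p)%:E) ->
  exists2 M : nat, (0 < M)%N &
    forall (B : nat -> forall k, set (k.-tuple X)) (b : nat -> R),
    (forall n k, measurable (B n k)) ->
    (forall n k, (n < k * M)%N ->
      (P' [set w | B n k [tuple xit i w | i < k]] <= (b k)%:E)%E) ->
    b k @[k --> \oo] --> 0 ->
    P [set w | B n _ (subtuple (xi^~ w) (pattern n (delta^~ w)))]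
      @[n --> \oo] --> 0%E.
Proof.
move=> p01 indep indep' true_law false_law.
have [M M0 sum_cvg] := pattern_weighted_sum_cvg0 p01.
have {}p01 : 0 <= p <= 1 by case/andP: p01 => /ltW -> ->.
exists M => // B b mB Bb b0.
under eq_fun do
  rewrite (pattern_event_prob p01 indep indep' true_law false_law _ (mB _)).
apply: cvg_EFin; first exact: nearW.
have mBt n k : measurable [set w | B n k [tuple xit i w | i < k]].
  exact: measurable_mktuple_preimage.
have Pfin n k : P' [set w | B n k [tuple xit i w | i < k]] \is a fin_num.
  exact: fin_num_measure.
apply: (sum_cvg (fun n k =>
  fine (P' [set w | B n k [tuple xit i w | i < k]])) b) => // n k.
  by rewrite fine_ge0 // -lee_fin fineK // probability_le1.
by move=> nk; rewrite -lee_fin fineK // Bb.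
Qed.

(** * Measurability of maps into ['rV[R]_m] through coordinates *)

Lemma measurable_coord d (T : measurableType d) (R : realType) m
    (f : T -> 'rV[R]_m) (j : 'I_m) :
  measurable_fun [set: T] (f : T -> borel_rV R m) ->
  measurable_fun [set: T] (fun y => f y ord0 j).
Proof.
move=> mf; apply: (measurability _ (RGenOInfty.measurableE R)) => //.
move=> _ [_ [a ->] <-].
apply: (mf measurableT [set v : 'rV[R]_m | v ord0 j \in `]a, +oo[%R]).
apply: sub_sigma_algebra.
apply: (@open_comp _ _ (fun v : 'rV[R]_m => v ord0 j) `]a, +oo[).
  by move=> v _; exact: coord_continuous.
exact: interval_open.
Qed.

(** The sup norm exceeds [e] exactly when some coordinate does. The maximum starts at [0], whence
    the condition [0 <= e]. *)
Lemma measurable_norm_rV_gt d (T : measurableType d) (R : realType) m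
    (f : T -> 'rV[R]_m) (e : R) : 0 <= e ->
  (forall j, measurable_fun [set: T] (fun y => f y ord0 j)) ->
  measurable [set y | e < `|f y|].
Proof.
move=> e0 mf.
rewrite (_ : [set y | _] =
    \bigcup_(j in [set: 'I_m]) ((fun y => `|f y ord0 j|) @^-1` `]e, +oo[)).
  apply: fin_bigcup_measurable => // j _; rewrite -[X in measurable X]setTI.
  have mn := measurableT_comp (@normr_measurable R setT) (mf j).
  exact: mn measurableT _ (measurable_itv _).
have normE (v : 'rV[R]_m) : `|v| = \big[Num.max/0]_ij `|v ij.1 ij.2| :> R.
  exact: mx_normrE.
apply/seteqP; split=> y /=; rewrite normE.
  move/bigmax_gtP => [|[[i j] _ /=]]; first by rewrite ltNge e0.
  by rewrite (ord1 i) => efy; exists j => //=; rewrite in_itv /= andbT.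
move=> [j _ /=]; rewrite in_itv /= andbT => efy.
by apply/bigmax_gtP; right; exists (ord0, j).
Qed.

(** [X^0] is a single point; this settles length zero, where nothing is assumed of [t 0]. *)
Lemma measurable_tuple0 d (X : measurableType d) (B : set (0.-tuple X)) :
  measurable B.
Proof.
have [B0|nB0] := pselect (B [tuple]).
  by rewrite (_ : B = setT) //; apply/seteqP; split=> // y _; rewrite tuple0.
by rewrite (_ : B = set0) //; apply/seteqP; split=> // y; rewrite tuple0.
Qed.

(** * The statistic and the mean as functions of the complete cases *)

(** The value [c] at length zero matches that of [complete_case_mean] when [N = 0]. *)
Definition tuple_mean (R : realType) m (X : Type) (psi : X -> 'rV[R]_m)
    (c : 'rV[R]_m) k (y : k.-tuple X) : 'rV[R]_m :=
  if k == 0%N then c else k%:R^-1 *: \sum_(i < k) psi (tnth y i).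

Lemma card_pattern n (dl : nat -> bool) : n_complete dl n = #|pattern n dl|.
Proof.
rewrite -sum1_card /n_complete [RHS]big_mkcond /=.
by apply: eq_bigr => j _; rewrite inE; case: (dl j).
Qed.

(** Only the observed pattern survives in the sum: any other [A] differs from it at some [j], where
    either the factor [dl j] or the factor [1 - dl j] is zero. *)
Lemma complete_case_pattern (R : realType) m (X : Type)
    (t : forall k, k.-tuple X -> 'rV[R]_m) n (dl : nat -> bool) (x : nat -> X) :
  complete_case t n dl x = t _ (subtuple x (pattern n dl)).
Proof.
rewrite /complete_case (bigD1 (pattern n dl)) //= [X in _ + X]big1 => [|A Apat].
  rewrite addr0 [X in X * _]big1 => [|j]; last by rewrite inE => ->.
  rewrite big1 ?mulr1 ?scale1r // => j.
  by rewrite inE => /negbTE ->; rewrite subr0.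
have [j jA] : exists j, (j \in A) != (j \in pattern n dl).
  apply/existsP; apply: contraR Apat; rewrite negb_exists => /forallP eqA.
  by apply/eqP/setP => j; apply/eqP; have := eqA j; rewrite negbK.
rewrite inE in jA; case: (boolP (j \in A)) jA => jA.
  case dlj: (dl j) => // _.
  by rewrite (bigD1 j) //= dlj !mul0r scale0r.
case dlj: (dl j) => // _.
by rewrite [X in _ * X](bigD1 j) //= dlj subrr mul0r mulr0 scale0r.
Qed.

Lemma complete_case_mean_pattern (R : realType) m (X : Type)
    (psi : X -> 'rV[R]_m) (c : 'rV[R]_m) n (dl : nat -> bool) (x : nat -> X) :
  complete_case_mean psi c n dl x =
  tuple_mean psi c (subtuple x (pattern n dl)).
Proof.
rewrite /complete_case_mean /tuple_mean card_pattern; case: eqP => // _.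
congr (_ *: _).
rewrite [RHS](eq_bigr (fun k : 'I_#|pattern n dl| => psi (x (enum_val k))))
  => [|k _]; last first.
  by rewrite tnth_mktuple.
rewrite -(big_enum_val (fun j : 'I_n => psi (x j))) [RHS]big_mkcond /=.
by apply: eq_bigr => j _; rewrite inE; case: (dl j); rewrite ?scale1r ?scale0r.
Qed.

Lemma measurable_deviation_gt (R : realType) m dX (X : measurableType dX)
    (t : forall k, k.-tuple X -> 'rV[R]_m)
    (psi : X -> 'rV[R]_m) (c : 'rV[R]_m) (a e : R) k :
  ((1 <= k)%N ->
    measurable_fun [set: k.-tuple X] (t k : k.-tuple X -> borel_rV R m)) ->
  measurable_fun [set: X] (psi : X -> borel_rV R m) ->
  0 <= e ->
  measurable [set y : k.-tuple X | e < `|a *: (t k y - tuple_mean psi c y)|].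
Proof.
case: k => [*|k /(_ isT) mt mpsi e0]; first exact: measurable_tuple0.
apply: measurable_norm_rV_gt => // j.
rewrite [X in measurable_fun _ X](_ : _ = (fun y : k.+1.-tuple X => a *
    (t _ y ord0 j -
       k.+1%:R^-1 * \sum_(i < k.+1) psi (tnth y i) ord0 j))); last first.
  by apply/funext => y; rewrite !mxE summxE.
apply: measurable_funM => //; apply: measurable_funB.
  exact: measurable_coord.
apply: measurable_funM => //; apply: measurable_sum => i.
apply: (measurableT_comp (f := fun x : X => psi x ord0 j)).
  exact: measurable_coord.
exact: measurable_tnth.
Qed.

Theorem mainTheorem9 (R : realType) (m : nat)
    (dX : measure_display) (X : measurableType dX)
    (t : forall k : nat, k.-tuple X -> 'rV[R]_m)
    (mt : forall k : nat, (1 <= k)%N ->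
      measurable_fun [set: k.-tuple X] (t k : k.-tuple X -> borel_rV R m))
    (psi : X -> 'rV[R]_m)
    (mpsi : measurable_fun [set: X] (psi : X -> borel_rV R m))
    (c : 'rV[R]_m)
    (* the generic pair (delta, xi) *)
    (d0 : measure_display) (Omega0 : measurableType d0)
    (P0 : probability Omega0 R)
    (delta0 : {RV P0 >-> bool}) (xi0 : {RV P0 >-> X})
    (p : R) (p_gt0 : 0 < p) (p_le1 : p <= 1)
    (delta0_bernoulli : forall B : set bool,
      distribution P0 delta0 B = bernoulli_prob p B)
    (* independent copies of (delta, xi) *)
    (d : measure_display) (Omega : measurableType d) (P : probability Omega R)
    (delta : nat -> {RV P >-> bool}) (xi : nat -> {RV P >-> X})
    (copies_indep :
      mutually_independent P (fun j w => (delta j w, xi j w)))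
    (copies_law : forall (j : nat) (C : set (bool * X)), measurable C ->
      P [set w | C (delta j w, xi j w)] =
      P0 [set w | C (delta0 w, xi0 w)])
    (* independent variables with the law of xi given delta = 1 *)
    (d' : measure_display) (Omega' : measurableType d')
    (P' : probability Omega' R)
    (xit : nat -> {RV P' >-> X})
    (xit_indep : mutually_independent P' (fun j w => xit j w))
    (xit_law : forall (j : nat) (B : set X), measurable B ->
      P' (xit j @^-1` B) =
      (P0 ((delta0 @^-1` [set true]) `&` (xi0 @^-1` B)) /
       P0 (delta0 @^-1` [set true]))%E)
    (t_expansion : oP1 P' (fun n w =>
      Num.sqrt (n%:R : R) *:
        (t n [tuple xit j w | j < n]
         - n%:R^-1 *: \sum_(j < n) psi (xit j w)))) :
  let dl w j := delta j w in
  let x w j := xi j w in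
  let N n w := n_complete (dl w) n in
  let Tc n w := complete_case t n (dl w) (x w) in
  let mean n w := complete_case_mean psi c n (dl w) (x w) in
  oP1 P (fun n w => Num.sqrt ((N n w)%:R : R) *: (Tc n w - mean n w)) /\
  oP P (fun n => (Num.sqrt (n%:R : R))^-1) (fun n w => Tc n w - mean n w).
Proof.
move=> dl x N Tc mean.
have p01 : 0 < p <= 1 by rewrite p_gt0.
have p01' : 0 <= p <= 1 by rewrite ltW.
have prob_true : P0 (delta0 @^-1` [set true]) = p%:E.
  have := delta0_bernoulli [set true]; rewrite bernoulli_probE //.
  by rewrite !diracE mem_set // memNset // mule1 mule0 adde0 => <-.
have prob_false : P0 (delta0 @^-1` [set false]) = (1 - p)%:E.
  have := delta0_bernoulli [set false]; rewrite bernoulli_probE //.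
  by rewrite !diracE memNset // mem_set // mule1 mule0 add0e => <-.
(* The conditional law with its denominator cleared, which is possible because [p > 0]. *)
have true_law j k (B : set X) : measurable B ->
    P [set w | delta j w /\ B (xi j w)] = (p%:E * P' (xit k @^-1` B))%E.
  move=> mB; pose C : set (bool * X) := [set true] `*` B.
  rewrite (_ : [set w | _] = [set w | C (delta j w, xi j w)]) //.
  rewrite copies_law; last exact: measurableX.
  rewrite xit_law // prob_true.
  set E := [set w | _].
  have -> : (delta0 @^-1` [set true]) `&` (xi0 @^-1` B) = E by [].
  have mE : measurable E.
    rewrite (_ : E = (delta0 @^-1` [set true]) `&` (xi0 @^-1` B)) //.
    by apply: measurableI; exact: measurable_funPTI.
  rewrite -(fineK (fin_num_measure P0 E mE)) inver gt_eqF // -!EFinM.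
  by rewrite mulrCA divff ?mulr1 // gt_eqF.
have false_law j : P [set w | ~~ delta j w] = (1 - p)%:E.
  pose C : set (bool * X) := [set false] `*` setT.
  rewrite (_ : [set w | _] = [set w | C (delta j w, xi j w)]); last first.
    by apply/seteqP; split=> w /=; [move=> /negbTE wd; split | move=> [/= ->]].
  rewrite copies_law; last exact: measurableX.
  rewrite -prob_false; congr (P0 _).
  by apply/seteqP; split=> w; [move=> []|].
have [M M0 events_cvg] :=
  pattern_events_cvg0 p01 copies_indep xit_indep true_law false_law.
pose dev k (y : k.-tuple X) := t k y - tuple_mean psi c y.
have devE n w : Tc n w - mean n w = dev _ (subtuple (x w) (pattern n (dl w))).
  by rewrite /Tc /mean complete_case_pattern complete_case_mean_pattern.
(* The probability from the hypothesis as a real number; it is tied to [dev] only for [k > 0], since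
   [tuple_mean] is [c] at [k = 0]. *)
pose b (e : R) k := fine (P' [set w | e < `|Num.sqrt k%:R *:
  (t k [tuple xit j w | j < k] - k%:R^-1 *: \sum_(j < k) psi (xit j w))|]).
have b_cvg (e : R) : 0 < e -> b e k @[k --> \oo] --> 0.
  by move=> /t_expansion /fine_cvgP[].
have mdev (a e : R) k : 0 < e ->
    measurable [set y : k.-tuple X | e < `|a *: dev k y|].
  by move=> /ltW; apply: measurable_deviation_gt => //; exact: mt.
have mdev_xit (a e : R) k : 0 < e ->
    measurable [set w | e < `|a *: dev k [tuple xit j w | j < k]|].
  move=> e0.
  have mxit (i : 'I_k) : measurable_fun [set: Omega'] (xit i) by [].
  exact: measurable_mktuple_preimage mxit (mdev a e k e0).
have dev_tupleE k w : (0 < k)%N -> dev k [tuple xit j w | j < k] =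
    t k [tuple xit j w | j < k] - k%:R^-1 *: \sum_(j < k) psi (xit j w).
  rewrite /dev /tuple_mean => /prednK <- /=; congr (_ - _ *: _).
  by apply: eq_bigr => j _; rewrite tnth_mktuple.
have b_sqrt (e : R) k : 0 < e -> (0 < k)%N ->
    P' [set w | e < `|Num.sqrt k%:R *: dev k [tuple xit j w | j < k]|] =
    (b e k)%:E.
  move=> e0 k0; rewrite /b; under eq_set do rewrite dev_tupleE //.
  rewrite fineK //; apply: fin_num_measure.
  under eq_set do rewrite -dev_tupleE //.
  exact: mdev_xit.
split=> e e0.
  pose B (n k : nat) := [set y : k.-tuple X | e < `|Num.sqrt k%:R *: dev k y|].
  under eq_fun do under eq_set do rewrite devE /N card_pattern.
  apply: (events_cvg B (b e)) => [n k|n k nk|]; [exact: mdev| |exact: b_cvg].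
  (* [n < k * M] forces [k > 0]. *)
  by rewrite b_sqrt // -(ltn_pmul2r M0) mul0n (leq_ltn_trans _ nk).
(* [n < k * M] gives [sqrt n <= sqrt k * sqrt M]. *)
pose sM : R := Num.sqrt M%:R.
have sM0 : 0 < sM by rewrite sqrtr_gt0 ltr0n.
have esM0 : 0 < e / sM by rewrite divr_gt0.
(* The double inverse comes from [oP] with rate [n^(-1/2)]; it equals [sqrt n], also at [n = 0],
   because [0^-1 = 0]. *)
pose B (n k : nat) :=
  [set y : k.-tuple X | e < `|(Num.sqrt n%:R)^-1^-1 *: dev k y|].
under eq_fun do under eq_set do rewrite devE.
apply: (events_cvg B (b (e / sM))) => [n k|n k nk|];
  [exact: mdev| |exact: b_cvg].
have k0 : (0 < k)%N by rewrite -(ltn_pmul2r M0) mul0n (leq_ltn_trans _ nk).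
rewrite -b_sqrt //; apply: le_measure; rewrite ?inE.
- exact: mdev_xit.
- exact: mdev_xit.
(* Inclusion of events: a deviation above [e] after scaling by [sqrt n] is above [e / sM] after
   scaling by [sqrt k]. *)
move=> w; rewrite /B /= invrK !normrZ !ger0_norm ?sqrtr_ge0 // ltr_pdivrMr //.
move=> /lt_le_trans; apply; rewrite mulrAC ler_wpM2r //.
by rewrite -sqrtrM // ler_wsqrtr // -natrM ler_nat ltnW.
Qed.
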